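(* For the Tchebychev polynomials of the first kind $T_k(x)$ and every natural number $k\ge 1$ we have \[T_{k}(x)=\left|\begin{array}{rrrrrr} x&-1&0&\cdots&0&0\\ -1&2x&-1&\cdots&0&0\\ 0&-1&2x&\cdots&0&0\\ \vdots&\vdots&\vdots&\ddots&\vdots&\vdots\\ 0&0&0&\cdots&2x&-1\\ 0&0&0&\cdots&-1&2x\end{array}\right|,\] where the determinant has size $k$; that is, the matrix is the $k\times k$ tridiagonal matrix with $(1,1)$ entry $x$, all other diagonal entries equal to $2x$, and all superdiagonal and subdiagonal entries equal to $-1$.
   Context: The Tchebychev (Chebyshev) polynomials of the first kind are defined by $T_0(x)=1$, $T_1(x)=x$, and $T_k(x)=-T_{k-2}(x)+2xT_{k-1}(x)$ for $k\ge 2$. *)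

(* Defs.v *)
From mathcomp Require Import all_boot all_order all_algebra.

Set Implicit Arguments.
Unset Strict Implicit.
Unset Printing Implicit Defensive.

Import GRing.Theory.
Local Open Scope ring_scope.

(* Formal polynomials over an arbitrary commutative ring; R = int gives the
   integral Tchebychev polynomials, R a real field the usual real ones. *)
Fixpoint chebyshevT (R : comNzRingType) (k : nat) {struct k} : {poly R} :=
  match k with
  | 0 => 1
  | k'.+1 =>
    match k' with
    | 0 => 'X
    | k''.+1 => - chebyshevT R k'' + 2 * 'X * chebyshevT R k'
    end
  end.

(* Indices start at 0, so the (1,1) entry of the text is the entry at (0,0). *)
Definition chebyshevT_mx (R : comNzRingType) (k : nat) : 'M[{poly R}]_k :=
  \matrix_(i < k, j < k)
    if i == j then (if val i == 0%N then 'X else 2 * 'X)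
    else if (i.+1 == j) || (j.+1 == i) then -1
    else 0.

(* Main.v *)
Require Import Defs.
From mathcomp Require Import all_boot all_order all_algebra.

Import GRing.Theory.

Local Open Scope ring_scope.

(** The determinants of the leading blocks of a tridiagonal matrix, known as
    continuants, satisfy a three-term recurrence ([det_tridiag_mxSS]): expanding
    along the last row leaves the last diagonal entry times the previous
    continuant, minus the product of the last two off-diagonal entries times
    the one before it.  For the matrix of the theorem, where the last diagonal
    entry is [2 * 'X] from size 2 on and the off-diagonal product is
    [(-1) * (-1) = 1], this is the Chebyshev recurrence.  The initial values
    agree too, because the determinant of size 0 is [1], so the identity
    follows by two-step induction on the size. *)

(** The entries are sequences indexed by [nat], independent of the size, so
    that the leading blocks of [tridiag_mx d b c n] have the same form. *)
Definition tridiag_mx (A : pzRingType) (d b c : nat -> A) (n : nat) : 'M[A]_n :=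
  \matrix_(i < n, j < n)
    if i == j :> nat then d i
    else if i.+1 == j then b i
    else if j.+1 == i then c j
    else 0.

Lemma bump_lt (h i : nat) : (i < h)%N -> bump h i = i.
Proof. by move=> lt_ih; rewrite /bump leqNgt lt_ih. Qed.

Lemma row'_col'_max_tridiag_mx (A : pzRingType) (d b c : nat -> A) (n : nat) :
  row' ord_max (col' ord_max (tridiag_mx A d b c n.+1)) = tridiag_mx A d b c n.
Proof. by apply/matrixP=> i j; rewrite !mxE !lift_max. Qed.

(** The minor that goes with the last subdiagonal entry.  It is not
    tridiagonal, but its last column vanishes except for the superdiagonal
    entry [b n] at the bottom, and expanding along that column leaves a leading
    block. *)
Lemma det_minor_subdiag_tridiag_mx (A : comPzRingType) (d b c : nat -> A)
    (n : nat) (k : 'I_n.+2) (hk : val k = n) :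
  \det (row' ord_max (col' k (tridiag_mx A d b c n.+2)))
    = b n * \det (tridiag_mx A d b c n).
Proof.
have lift_lt (j : 'I_n) : bump k (bump n j) = j.
  by rewrite (bump_lt n) // bump_lt // [X in (_ < X)%N]hk.
have lift_n : bump k n = n.+1 by rewrite [X in bump X]hk /bump leqnn.
rewrite (expand_det_col _ ord_max) big_ord_recr /= big1 ?add0r => [|i _].
  rewrite !mxE lift_max /= lift_n ltn_eqF // eqxx.
  rewrite /cofactor -signr_odd oddD addbb mul1r; congr (_ * \det _).
  by apply/matrixP=> i j; rewrite !mxE !lift_max /= lift_lt.
rewrite !mxE lift_max /= lift_n eqSS.
have lt_in1 : (i < n.+1)%N by rewrite leqW.
have lt_in2 : (i < n.+2)%N by rewrite leqW.
by rewrite (ltn_eqF lt_in1) (ltn_eqF (ltn_ord i)) (gtn_eqF lt_in2) mul0r.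
Qed.

(** In the last row only the subdiagonal entry [c n] and the diagonal entry
    [d n.+1] can be nonzero. *)
Lemma det_tridiag_mxSS (A : comPzRingType) (d b c : nat -> A) (n : nat) :
  \det (tridiag_mx A d b c n.+2)
    = d n.+1 * \det (tridiag_mx A d b c n.+1)
      - b n * c n * \det (tridiag_mx A d b c n).
Proof.
rewrite (expand_det_row _ ord_max) !big_ord_recr /= big1 ?add0r => [|i _].
  rewrite /cofactor det_minor_subdiag_tridiag_mx // row'_col'_max_tridiag_mx.
  rewrite !mxE /= !eqxx [n.+1 == n]gtn_eqF // [n.+2 == n]gtn_eqF //.
  have sign_even m : (-1 : A) ^+ (m + m) = 1 by rewrite exprD -expr2 sqrr_sign.
  rewrite addSn exprS !sign_even mulr1 mul1r.
  by rewrite addrC mulN1r mulrN mulrA [c n * b n]mulrC.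
rewrite !mxE /= eqSS.
have lt_in1 : (i < n.+1)%N by rewrite leqW.
have lt_in2 : (i < n.+2)%N by rewrite leqW.
by rewrite (gtn_eqF lt_in1) (gtn_eqF lt_in2) (ltn_eqF (ltn_ord i)) mul0r.
Qed.

Lemma chebyshevT_mxE (R : comNzRingType) (k : nat) :
  chebyshevT_mx R k
    = tridiag_mx _ (fun i => if i == 0%N then 'X else 2 * 'X)
        (fun=> -1) (fun=> -1) k.
Proof.
apply/matrixP=> i j; rewrite !mxE -val_eqE /=.
by do 3?case: eqP.
Qed.

Theorem proposition2p4 (R : comNzRingType) (k : nat) (hk : (1 <= k)%N) :
  chebyshevT R k = \det (chebyshevT_mx R k).
Proof.
(* The recurrence looks two sizes back, so consecutive sizes go together, and
   the induction starts at size 0. *)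
suff [] : chebyshevT R k = \det (chebyshevT_mx R k)
  /\ chebyshevT R k.+1 = \det (chebyshevT_mx R k.+1) by [].
elim: k {hk} => [|k [IHk IHk1]]; first by rewrite det_mx00 det_mx11 mxE.
split=> //; rewrite chebyshevT_mxE det_tridiag_mxSS -!chebyshevT_mxE -IHk -IHk1.
by rewrite mulrNN !mul1r addrC.
Qed.
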